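(* For every integer $n>1$ the following hold. (a) $$\sum_{m=1}^{n-1}\sigma'_{1,5}(m,n-m) = \frac{540 n^7 -1134 n}{13608}\psi_{-1}(n) + \frac{n^5}{24}\psi_{1}(n) + \frac{9 n}{4536}\psi_{5}(n).$$ (b) $$\sum_{m=1}^{n-1}\sigma'_{3,3}(m,n-m) = \frac{n^7}{120} \psi_{-1}(n) - \frac{n^3}{120} \psi_{3}(n).$$
   Context: $\mathbb{N}$ denotes the set of positive integers and $\mathbb{N}_0=\mathbb{N}\cup\{0\}$. For $m,n\in\mathbb{N}$ and $r,s\in\mathbb{N}_0$, $$\sigma'_{r,s}(m,n)=\sum_{\substack{(d,e)\in\mathbb{N}^2\\ d\mid m,\ e\mid n\\ \gcd(d,e)=\gcd(m/d,\,n/e)=1}} d^r e^s.$$ For $n\in\mathbb{N}$ and $s\in\mathbb{Z}\setminus\{0\}$, $\psi_s(n)=\sum_{d\mid n}\mu(d)d^s$, where the sum is over positive divisors $d$ of $n$ and $\mu$ is the Möbius function. *)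

(* Defs.v *)
From mathcomp Require Import all_boot all_order all_algebra.
Set Implicit Arguments.
Unset Strict Implicit.
Unset Printing Implicit Defensive.
Import Order.TTheory GRing.Theory Num.Theory.

(* The arguments m and n are meant to be positive: [divisors 0] is empty. *)
Definition sigma' (r s m n : nat) : nat :=
  \sum_(d <- divisors m)
    \sum_(e <- divisors n | coprime d e && coprime (m %/ d) (n %/ e))
      d ^ r * e ^ s.

Local Open Scope ring_scope.

(* For n > 0, the condition says that n is squarefree; n = 0 is irrelevant. *)
Definition moebius (n : nat) : int :=
  if all (fun p => logn p n == 1%N) (primes n) then (-1) ^+ size (primes n)
  else 0.

(* The exponent s is a (possibly negative) integer, so values are rational. *)
Definition psi (s : int) (n : nat) : rat :=
  \sum_(d <- divisors n) (moebius d)%:~R * (d%:R : rat) ^ s.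

(* Main.v *)
Require Import Defs.
From mathcomp Require Import all_boot all_order all_algebra.
From mathcomp Require Import ring lra zify.
Import Order.TTheory GRing.Theory Num.Theory.
Local Open Scope ring_scope.

(**
  Writing m = a x and n - m = b y, the sum of sigma'_{r,s}(m, n - m) becomes
  the sum of a^r b^s over the quadruples of positive integers (a, b, x, y)
  such that a x + b y = n and gcd(a, b) = gcd(x, y) = 1.  The substitution
      (a, b, x, y) |-> (a, a + b, x - y, y)
  is a bijection from those quadruples with y < x to those with a < b.  Hence,
  if f is symmetric, even, and satisfies f(a, b - a) = f(a, - b), the sum of
  f(a, b) over y < x is the sum of f(a, - b) over a < b.  By symmetry each of
  these is half of the corresponding sum over all the quadruples with x <> y,
  resp. a <> b.  So the sum of f(a, b) - f(a, - b) over all quadruples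
  reduces to the diagonals x = y and a = b, where coprimality forces x = y = 1,
  resp. a = b = 1 ([sum_prim_quads_descent]):
      sum (f(a, b) - f(a, - b))
        = sum_{0 < a < n, gcd(a, n) = 1} (f(a, n - a) - f(1, - 1)).

  The conditions on f say that it is an even function invariant under the
  permutations of the triple (a, b, - a - b).  In degree 6 such
  polynomials form a space of dimension 2, and a basis of it suffices:
  - f = a^2 b^2 (a + b)^2 gives f(a, b) - f(a, - b) = 4 a^3 b^3;
  - f = (a^2 + a b + b^2)^3 gives
      f(a, b) - f(a, - b) = 6 a b^5 + 6 a^5 b + 14 a^3 b^3.
  The remaining sums over the integers coprime to n are evaluated by Moebius
  inversion ([sum_coprime_mul]) and the formulas for sums of powers, which
  yields the combinations of psi in the statement.
*)

(** * Reindexing of sums *)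

(** Change of variables along a bijection [g], with inverse [h], between the
  part of [s] selected by [P] and the part of [t] selected by [Q]. *)
Lemma sum_seq_bij (V : nmodType) (I J : eqType) (s : seq I) (t : seq J)
    (P : pred I) (Q : pred J) (g : I -> J) (h : J -> I) (F : J -> V) :
    uniq s -> uniq t ->
    (forall i, i \in s -> P i -> [/\ g i \in t, Q (g i) & h (g i) = i]) ->
    (forall j, j \in t -> Q j -> [/\ h j \in s, P (h j) & g (h j) = j]) ->
  \sum_(i <- s | P i) F (g i) = \sum_(j <- t | Q j) F j.
Proof.
move=> s_uniq t_uniq gP hP.
rewrite -[LHS]big_filter -[RHS]big_filter -(big_map g xpredT F).
apply: perm_big; apply: uniq_perm; rewrite ?filter_uniq //.
  rewrite map_inj_in_uniq ?filter_uniq // => i1 i2.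
  rewrite !mem_filter => /andP[P1 s1] /andP[P2 s2] eq_g.
  by have [_ _ <-] := gP _ s1 P1; rewrite eq_g; have [] := gP _ s2 P2.
move=> j; rewrite mem_filter; apply/mapP/andP => [[i]|[Qj tj]].
  by rewrite mem_filter => /andP[Pi si] ->; have [] := gP _ si Pi.
have [sh Ph ghj] := hP _ tj Qj.
by exists (h j); rewrite ?mem_filter ?Ph.
Qed.

(** * The Moebius function and sums over integers coprime to n *)

Lemma moebiusM_prime (p d : nat) : prime p -> (0 < d)%N -> ~~ (p %| d)%N ->
  moebius (p * d) = - moebius d.
Proof.
move=> p_prime d_gt0 pNd; have p_gt0 := prime_gt0 p_prime.
have primes_pd : perm_eq (primes (p * d)) (p :: primes d).
  apply: uniq_perm => [||q]; rewrite /= ?primes_uniq ?andbT //.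
    by rewrite mem_primes p_prime d_gt0 (negPf pNd).
  by rewrite primesM // primes_prime // !inE.
rewrite /moebius (perm_all _ primes_pd) (perm_size primes_pd) /=.
have logp : logn p (p * d) = 1%N.
  by rewrite lognM // logn_prime // eqxx lognE (negPf pNd) !andbF.
rewrite logp eqxx /= (@eq_in_all _ _ (fun q => logn q d == 1%N)) => [|q].
  by case: ifP; rewrite ?oppr0 // exprS mulN1r.
rewrite mem_primes => /and3P[q_prime _ q_d].
rewrite lognM // logn_prime //.
by have [eq_qp|] := eqVneq q p; first by rewrite -eq_qp q_d in pNd.
Qed.

Lemma moebius_sqr_dvd (p d : nat) : prime p -> (0 < d)%N -> (p ^ 2 %| d)%N ->
  moebius d = 0.
Proof.
move=> p_prime d_gt0; rewrite pfactor_dvdn // => log_gt1.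
rewrite /moebius ifN //; apply/allPn; exists p.
  by rewrite -logn_gt0; apply: ltnW.
by case: eqP log_gt1 => // ->.
Qed.

(** For a prime [p] dividing [k], multiplication by [p] matches the divisors
  of [k] prime to [p] with those that [p] divides exactly once, and it changes
  the sign of [moebius]; the divisors that [p ^ 2] divides contribute zero. *)
Lemma sum_moebius_divisors (k : nat) : (0 < k)%N ->
  \sum_(d <- divisors k) moebius d = (k == 1%N)%:R :> int.
Proof.
move=> k_gt0; case: eqP => [-> | /eqP k_neq1]; first by rewrite big_seq1.
have [p p_prime p_k] : {p | prime p & (p %| k)%N}.
  by apply: pdivP; rewrite ltn_neqAle eq_sym k_neq1.
have p_gt0 := prime_gt0 p_prime.
rewrite (bigID (fun d => p %| d)%N) /=.
rewrite (bigID (fun d => p ^ 2 %| d)%N) /= big_seq_cond big1 ?add0r; last first.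
  move=> d /and3P[]; rewrite -dvdn_divisors // => /dvdn_gt0 d_gt0 _.
  by apply: moebius_sqr_dvd => //; apply: d_gt0.
apply/eqP; rewrite addr_eq0 -sumrN; apply/eqP.
rewrite [RHS]big_seq_cond.
under [RHS]eq_bigr => d /andP[d_k pNd].
  rewrite -(@moebiusM_prime p) //; last first.
    by move: d_k; rewrite -dvdn_divisors // => /dvdn_gt0; apply.
  over.
rewrite -big_seq_cond; apply/esym.
apply: (@sum_seq_bij _ _ _ _ _ _ _ (muln p) (fun d => d %/ p)%N moebius);
  rewrite ?divisors_uniq // => d; rewrite -!dvdn_divisors // => d_k.
  move=> pNd; rewrite dvdn_mulr // mulKn // expnS expn1 dvdn_pmul2l //.
  by rewrite Gauss_dvd ?p_k ?d_k // prime_coprime.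
case/andP=> /dvdnP[e def_d]; rewrite def_d mulnK // in d_k *.
rewrite expnS expn1 [(e * p)%N]mulnC dvdn_pmul2l // => pNe; split=> //.
by apply: dvdn_trans d_k; apply: dvdn_mulr.
Qed.

(** The indicator of [coprime a n] is the sum of [moebius d] over the common
  divisors [d] of [a] and [n]. *)
Lemma sum_coprime (R : pzRingType) (n : nat) (G : nat -> R) : (0 < n)%N ->
  \sum_(1 <= a < n.+1 | coprime a n) G a =
  \sum_(d <- divisors n)
    (moebius d)%:~R * \sum_(1 <= j < (n %/ d).+1) G (d * j)%N.
Proof.
move=> n_gt0.
have coprimeE a : (coprime a n)%:R =
    \sum_(d <- divisors n | (d %| a)%N) (moebius d)%:~R :> R.
  have g_gt0 : (0 < gcdn a n)%N by rewrite gcdn_gt0 n_gt0 orbT.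
  rewrite -rmorph_sum /= -[LHS](rmorph_nat intr) -sum_moebius_divisors //=.
  congr (_%:~R); rewrite -[RHS]big_filter; apply: perm_big; apply: uniq_perm.
  - exact: divisors_uniq.
  - by rewrite filter_uniq ?divisors_uniq.
  by move=> d; rewrite mem_filter -!dvdn_divisors // dvdn_gcd.
transitivity (\sum_(1 <= a < n.+1) \sum_(d <- divisors n | (d %| a)%N)
                (moebius d)%:~R * G a).
  rewrite big_mkcond; apply: eq_bigr => a _.
  by rewrite -mulr_suml -coprimeE; case: coprime; rewrite ?mul1r ?mul0r.
rewrite (exchange_big_dep xpredT) //= big_seq [RHS]big_seq.
apply: eq_bigr => d; rewrite -dvdn_divisors // => d_n; rewrite -mulr_sumr.
have d_gt0 := dvdn_gt0 n_gt0 d_n.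
congr (_ * _); apply/esym.
apply: (@sum_seq_bij _ _ _ _ _ _ _ (muln d) (fun a => a %/ d)%N G);
  rewrite ?iota_uniq // => j; rewrite !mem_index_iota !ltnS.
  move=> /andP[j_gt0 j_le] _.
  rewrite muln_gt0 d_gt0 j_gt0 dvdn_mulr // mulKn //.
  by rewrite mulnC -leq_divRL.
move=> /andP[j_gt0 j_le] dj.
rewrite divn_gt0 // dvdn_leq // leq_div2r //; split=> //.
by rewrite mulnC divnK.
Qed.

(** * Primitive representations n = a x + b y *)

(** The quadruples ((a, b), (x, y)) of positive integers such that
  a x + b y = n, gcd (a, b) = 1 and gcd (x, y) = 1, listed without repetition.
  All the components are at most n, so that a search in a box is enough. *)
Definition prim_quads (n : nat) : seq ((nat * nat) * (nat * nat)) :=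
  let box := [seq (u, v) | u <- iota 1 n, v <- iota 1 n] in
  [seq q <- [seq (u, v) | u <- box, v <- box]
     | [&& q.1.1 * q.2.1 + q.1.2 * q.2.2 == n,
           coprime q.1.1 q.1.2 & coprime q.2.1 q.2.2]%N].

Lemma prim_quads_uniq (n : nat) : uniq (prim_quads n).
Proof.
rewrite filter_uniq //; apply: allpairs_uniq => [||[u v] [u' v'] _ _] //;
  by apply: allpairs_uniq => [||[? ?] [? ?] _ _] //; apply: iota_uniq.
Qed.

Lemma mem_prim_quads (n a b x y : nat) :
  (((a, b), (x, y)) \in prim_quads n) =
  [&& (0 < a)%N, (0 < b)%N, (0 < x)%N, (0 < y)%N, (a * x + b * y == n)%N,
      coprime a b & coprime x y].
Proof.
rewrite mem_filter /=.
have memP (T U : eqType) (s : seq T) (t : seq U) u v :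
    ((u, v) \in [seq (u, v) | u <- s, v <- t]) = (u \in s) && (v \in t).
  apply/allpairsP/andP => [[[u' v'] [? ? [-> ->]]] // | [? ?]].
  by exists (u, v).
rewrite !memP !mem_iota.
case: (coprime a b); last by rewrite !andbF.
case: (coprime x y); last by rewrite !andbF.
by apply/idP/idP; [lia | nia].
Qed.

(** The quadruple attached to m, a divisor d of m and a divisor e of n - m is
  ((d, e), (m / d, (n - m) / e)). *)
Lemma sum_sigma'E (r s n : nat) :
  (\sum_(1 <= m < n) sigma' r s m (n - m) =
   \sum_(q <- prim_quads n) q.1.1 ^ r * q.1.2 ^ s)%N.
Proof.
transitivity (\sum_(1 <= m < n) \sum_(q <- prim_quads n | q.1.1 * q.2.1 == m)
                q.1.1 ^ r * q.1.2 ^ s)%N; last first.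
  rewrite (exchange_big_dep xpredT) //= big_seq [RHS]big_seq.
  apply: eq_bigr => -[[a b] [x y]]; rewrite mem_prim_quads /= => q_n.
  rewrite (eq_bigl (fun m => m == a * x)%N) => [|m]; last by rewrite eq_sym.
  by rewrite big_nat1_eq ifT //; move: q_n; lia.
apply: eq_big_nat => m /andP[m_gt0 m_n]; rewrite /sigma'.
have k_gt0 : (0 < n - m)%N by rewrite subn_gt0.
under eq_bigr => d _ do rewrite big_mkcond /=.
rewrite -(@big_allpairs _ _ _ _ _ _ _ (fun u : nat * nat =>
  if coprime u.1 u.2 && coprime (m %/ u.1) ((n - m) %/ u.2)
  then u.1 ^ r * u.2 ^ s else 0)%N) -big_mkcond /=.
apply: (@sum_seq_bij _ _ _ _ _ _ _
  (fun u : nat * nat => (u, (m %/ u.1, (n - m) %/ u.2)%N)) fst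
  (fun q => q.1.1 ^ r * q.1.2 ^ s)%N).
- by apply: allpairs_uniq; rewrite ?divisors_uniq // => -[? ?] [? ?].
- exact: prim_quads_uniq.
- move=> _ /allpairsP[[d e] [d_m e_k ->]] /= /andP[co_de co_xy].
  move: d_m e_k; rewrite -!dvdn_divisors // => d_m e_k.
  have [d_gt0 e_gt0] := (dvdn_gt0 m_gt0 d_m, dvdn_gt0 k_gt0 e_k).
  rewrite mem_prim_quads co_de co_xy d_gt0 e_gt0 !divn_gt0 //.
  rewrite (dvdn_leq m_gt0 d_m) (dvdn_leq k_gt0 e_k).
  by rewrite [(d * _)%N]mulnC [(e * _)%N]mulnC !divnK // subnKC ?eqxx // ltnW.
move=> [[a b] [x y]]; rewrite mem_prim_quads /= => q_n /eqP def_m.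
have [a_gt0 b_gt0 def_k co_ab co_xy] :
    [/\ (0 < a)%N, (0 < b)%N, (n - m = b * y)%N, coprime a b & coprime x y].
  by split; move: q_n; lia.
rewrite def_k -def_m !mulKn // co_ab co_xy; split=> //.
apply/allpairsP; exists (a, b); split=> //=.
  by rewrite -dvdn_divisors ?dvdn_mulr // def_m.
by rewrite -dvdn_divisors ?dvdn_mulr // -def_k.
Qed.

Lemma sum_prim_quads_swap (V : nmodType) (n : nat)
    (P : pred ((nat * nat) * (nat * nat))) (F : nat -> nat -> V) :
  \sum_(q <- prim_quads n | P ((q.1.2, q.1.1), (q.2.2, q.2.1))) F q.1.2 q.1.1 =
  \sum_(q <- prim_quads n | P q) F q.1.1 q.1.2.
Proof.
pose swap (q : (nat * nat) * (nat * nat)) := ((q.1.2, q.1.1), (q.2.2, q.2.1)).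
apply: (@sum_seq_bij _ _ _ _ _ _ _ swap swap (fun q => F q.1.1 q.1.2));
  rewrite ?prim_quads_uniq // => -[[a b] [x y]];
  by rewrite !mem_prim_quads /= ![coprime _ a]coprime_sym
    ![coprime _ x]coprime_sym => q_n Pq; split=> //; move: q_n; lia.
Qed.

(** The bijection (a, b, x, y) |-> (a, a + b, x - y, y), which exists because
  a x + b y = a (x - y) + (a + b) y and which preserves both gcd conditions. *)
Lemma sum_prim_quads_shear (V : nmodType) (n : nat) (F : nat -> nat -> V) :
  \sum_(q <- prim_quads n | (q.2.2 < q.2.1)%N) F q.1.1 (q.1.1 + q.1.2)%N =
  \sum_(q <- prim_quads n | (q.1.1 < q.1.2)%N) F q.1.1 q.1.2.
Proof.
apply: (@sum_seq_bij _ _ _ _ _ _ _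
  (fun q => ((q.1.1, q.1.1 + q.1.2), (q.2.1 - q.2.2, q.2.2))%N)
  (fun q => ((q.1.1, q.1.2 - q.1.1), (q.2.1 + q.2.2, q.2.2))%N)
  (fun q => F q.1.1 q.1.2));
  rewrite ?prim_quads_uniq // => -[[a b] [x y]]; rewrite !mem_prim_quads /=.
  move=> q_n y_lt_x.
  have -> : coprime a (a + b) = coprime a b by rewrite /coprime gcdnDl.
  have -> : coprime (x - y) y = coprime x y.
    rewrite ![coprime _ y]coprime_sym -{2}(subnK (ltnW y_lt_x)).
    by rewrite /coprime gcdnDr.
  by split; rewrite ?addKn ?subnK //; nia.
move=> q_n a_lt_b.
have -> : coprime a (b - a) = coprime a b.
  by rewrite -{2}(subnK (ltnW a_lt_b)) /coprime gcdnDr.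
have -> : coprime (x + y) y = coprime x y.
  by rewrite ![coprime _ y]coprime_sym /coprime gcdnDr.
by split; rewrite ?addnK ?subnKC //; nia.
Qed.

(** If x = y, then x = y = 1 and a + b = n. *)
Lemma sum_prim_quads_eq_right (V : nmodType) (n : nat) (F : nat -> nat -> V) :
  \sum_(q <- prim_quads n | q.2.1 == q.2.2) F q.1.1 q.1.2 =
  \sum_(1 <= a < n | coprime a n) F a (n - a)%N.
Proof.
apply/esym.
apply: (@sum_seq_bij _ _ _ _ _ _ _ (fun a => ((a, n - a), (1, 1))%N)
  (fun q => q.1.1) (fun q => F q.1.1 q.1.2));
  rewrite ?prim_quads_uniq ?iota_uniq //.
  move=> a; rewrite mem_index_iota mem_prim_quads /= => /andP[a_gt0 a_n] co_an.
  have co_sub : coprime a (n - a).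
    by move: co_an; rewrite -{1}(subnK (ltnW a_n)) /coprime gcdnDr.
  by rewrite !muln1 subnKC ?(ltnW a_n) // a_gt0 subn_gt0 a_n eqxx co_sub.
move=> [[a b] [x y]]; rewrite mem_prim_quads mem_index_iota /=.
case/and5P=> a_gt0 b_gt0 x_gt0 y_gt0 /and3P[/eqP def_n co_ab co_xy] /eqP eq_xy.
move: co_xy def_n; rewrite eq_xy /coprime gcdnn => /eqP-> <-.
by rewrite !muln1 a_gt0 -[X in (X < _)%N]addn0 ltn_add2l b_gt0 addKn gcdnDl.
Qed.

(** If a = b, then a = b = 1 and x + y = n. *)
Lemma sum_prim_quads_eq_left (V : nmodType) (n : nat) (F : nat -> nat -> V) :
  \sum_(q <- prim_quads n | q.1.1 == q.1.2) F q.1.1 q.1.2 =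
  \sum_(1 <= a < n | coprime a n) F 1%N 1%N.
Proof.
apply/esym.
apply: (@sum_seq_bij _ _ _ _ _ _ _ (fun x => ((1, 1), (x, n - x))%N)
  (fun q => q.2.1) (fun q => F q.1.1 q.1.2));
  rewrite ?prim_quads_uniq ?iota_uniq //.
  move=> a; rewrite mem_index_iota mem_prim_quads /= => /andP[a_gt0 a_n] co_an.
  have co_sub : coprime a (n - a).
    by move: co_an; rewrite -{1}(subnK (ltnW a_n)) /coprime gcdnDr.
  by rewrite !mul1n subnKC ?(ltnW a_n) // a_gt0 subn_gt0 a_n eqxx co_sub.
move=> [[a b] [x y]]; rewrite mem_prim_quads mem_index_iota /=.
case/and5P=> a_gt0 b_gt0 x_gt0 y_gt0 /and3P[/eqP def_n co_ab co_xy] /eqP eq_ab.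
move: co_ab def_n co_xy; rewrite eq_ab /coprime gcdnn => /eqP-> <- co_xy.
by rewrite !mul1n x_gt0 -[X in (X < _)%N]addn0 ltn_add2l y_gt0 addKn gcdnDl.
Qed.

(** The off-diagonal parts of the sums of f(a, b) and of f(a, - b) cancel by
  [sum_prim_quads_shear], which leaves the two diagonals. *)
Lemma sum_prim_quads_descent (R : pzRingType) (V : zmodType) (n : nat)
    (f : R -> R -> V) :
    (forall a b, f a b = f b a) ->
    (forall a b, f (- a) (- b) = f a b) ->
    (forall a b, f a (b - a) = f a (- b)) ->
  \sum_(q <- prim_quads n)
     (f q.1.1%:R q.1.2%:R - f q.1.1%:R (- q.1.2%:R)) =
  \sum_(1 <= a < n | coprime a n) (f a%:R (n%:R - a%:R) - f 1 (- 1)).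
Proof.
move=> fC fN fS.
pose F (a b : nat) := f a%:R b%:R; pose G (a b : nat) := f a%:R (- b%:R).
(* A symmetric sum is twice its part below a diagonal plus the diagonal;
   u and v are two coordinates exchanged by (a, b, x, y) |-> (b, a, y, x). *)
have splitE (X : nat -> nat -> V) (u v : (nat * nat) * (nat * nat) -> nat) :
    (forall a b, X a b = X b a) ->
    (forall q, u ((q.1.2, q.1.1), (q.2.2, q.2.1)) = v q) ->
    (forall q, v ((q.1.2, q.1.1), (q.2.2, q.2.1)) = u q) ->
  \sum_(q <- prim_quads n) X q.1.1 q.1.2 =
  (\sum_(q <- prim_quads n | (u q < v q)%N) X q.1.1 q.1.2) *+ 2
  + \sum_(q <- prim_quads n | u q == v q) X q.1.1 q.1.2.
  move=> XC uE vE; rewrite (bigID (fun q => u q == v q)) addrC; congr (_ + _).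
  rewrite (bigID (fun q => u q < v q)%N) mulr2n /=; congr (_ + _).
    by apply: eq_bigl => q; rewrite ltn_neqAle andbA andbb.
  rewrite -sum_prim_quads_swap; apply: eq_big => [q|q _]; last exact: XC.
  by rewrite uE vE eq_sym -leqNgt ltn_neqAle.
have eqFG : \sum_(q <- prim_quads n | (q.2.2 < q.2.1)%N) F q.1.1 q.1.2 =
            \sum_(q <- prim_quads n | (q.1.1 < q.1.2)%N) G q.1.1 q.1.2.
  rewrite -sum_prim_quads_shear; apply: eq_bigr => q _.
  by rewrite /G -fS natrD addrC addKr.
rewrite sumrB (splitE F (fun q => q.2.2) (fun q => q.2.1)) //; last first.
  by move=> a b; apply: fC.
rewrite (splitE G (fun q => q.1.1) (fun q => q.1.2)) //; last first.
  by move=> a b; rewrite /G fC -fN opprK.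
rewrite eqFG opprD addrACA subrr add0r sumrB.
rewrite (eq_bigl (fun q => q.2.1 == q.2.2)) => [|q]; last exact: eq_sym.
rewrite sum_prim_quads_eq_right sum_prim_quads_eq_left; congr (_ - _).
rewrite big_nat_cond [RHS]big_nat_cond.
by apply: eq_bigr => a /andP[/andP[_ a_n] _]; rewrite /F natrB 1?ltnW.
Qed.

(** * Polynomial sums over integers coprime to n *)

(** For 1 < n, the value a = n is not coprime to n and may be left out. *)
Lemma sum_coprime_mul (R : pzRingType) (n : nat) (G : nat -> R) : (1 < n)%N ->
  \sum_(1 <= a < n | coprime a n) G a =
  \sum_(d <- divisors n)
    (moebius d)%:~R * \sum_(1 <= j < (n %/ d).+1) G (d * j)%N.
Proof.
move=> n_gt1; rewrite -sum_coprime; last exact: ltnW.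
rewrite [RHS]big_mkcond big_nat_recr; last exact: ltnW.
by rewrite -big_mkcond /= /coprime gcdnn gtn_eqF //= addr0.
Qed.

(** The proof uses the partial sums up to an arbitrary [M], for which [x] is
  independent of the bound, and the power sums s_k = 1^k + ... + M^k. *)
Lemma sum_sqr_mul_sub (N : nat) (d x : rat) : x = d * N%:R ->
  \sum_(1 <= j < N.+1) (d * j%:R) ^+ 2 * (x - d * j%:R) ^+ 2 =
  d ^+ 4 * (N%:R ^+ 5 - N%:R) / 30.
Proof.
have sumE (M : nat) :
   \sum_(1 <= j < M.+1) (d * j%:R) ^+ 2 * (x - d * j%:R) ^+ 2 =
   let m := M%:R in let s2 := m * (m + 1) * (2 * m + 1) / 6 in
   let s3 := m ^+ 2 * (m + 1) ^+ 2 / 4 in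
   let s4 := m * (m + 1) * (2 * m + 1) * (3 * m ^+ 2 + 3 * m - 1) / 30 in
   d ^+ 2 * (x ^+ 2 * s2 - 2 * x * d * s3 + d ^+ 2 * s4) :> rat.
  elim: M => [|M IH]; first by rewrite big_geq //=; field.
  by rewrite big_nat_recr //= IH /= -natr1; field.
by move=> def_x; rewrite sumE /= def_x; field.
Qed.

(** With t = d j (x - d j), the cube expands as x^6 - 3 x^4 t + 3 x^2 t^2 - t^3,
  and each power of t is summed over j by means of the s_k. *)
Lemma sum_cube_sub (N : nat) (d x : rat) : x = d * N%:R ->
  \sum_(1 <= j < N.+1) ((x ^+ 2 - d * j%:R * (x - d * j%:R)) ^+ 3 - 1) =
  d ^+ 6 * (83 / 140 * N%:R ^+ 7 + N%:R ^+ 5 / 2 - 7 / 60 * N%:R ^+ 3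
            + N%:R / 42) - N%:R.
Proof.
have sumE (M : nat) :
   \sum_(1 <= j < M.+1) ((x ^+ 2 - d * j%:R * (x - d * j%:R)) ^+ 3 - 1) =
   let m := M%:R in
   let s1 := m * (m + 1) / 2 in
   let s2 := m * (m + 1) * (2 * m + 1) / 6 in
   let s3 := m ^+ 2 * (m + 1) ^+ 2 / 4 in
   let s4 := m * (m + 1) * (2 * m + 1) * (3 * m ^+ 2 + 3 * m - 1) / 30 in
   let s5 := m ^+ 2 * (m + 1) ^+ 2 * (2 * m ^+ 2 + 2 * m - 1) / 12 in
   let s6 := m * (m + 1) * (2 * m + 1)
             * (3 * m ^+ 4 + 6 * m ^+ 3 - 3 * m + 1) / 42 in
   x ^+ 6 * m - 3 * x ^+ 4 * (x * d * s1 - d ^+ 2 * s2)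
   + 3 * x ^+ 2 * d ^+ 2 * (x ^+ 2 * s2 - 2 * x * d * s3 + d ^+ 2 * s4)
   - d ^+ 3 * (x ^+ 3 * s3 - 3 * x ^+ 2 * d * s4 + 3 * x * d ^+ 2 * s5
               - d ^+ 3 * s6) - m :> rat.
  elim: M => [|M IH]; first by rewrite big_geq //=; field.
  by rewrite big_nat_recr //= IH /= -natr1; field.
by move=> def_x; rewrite sumE /= def_x; field.
Qed.

Lemma sum_moebius_laurent (n : nat) (A B C D : rat) :
  \sum_(d <- divisors n)
     (moebius d)%:~R * (A / d%:R + B * d%:R + C * d%:R ^+ 3 + D * d%:R ^+ 5) =
  A * psi (-1) n + B * psi 1 n + C * psi 3 n + D * psi 5 n.
Proof.
rewrite /psi !mulr_sumr -!big_split; apply: eq_bigr => d _ /=.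
rewrite -exprnN -!exprnP !expr1.
by rewrite !mulrDr !(mulrCA _%:~R).
Qed.

(** Sum of the values f(a, n - a) / n^2 for f = a^2 b^2 (a + b)^2. *)
Lemma sum_coprime_sqr (n : nat) : (1 < n)%N ->
  \sum_(1 <= a < n | coprime a n) a%:R ^+ 2 * (n%:R - a%:R) ^+ 2 =
  (n%:R ^+ 5 * psi (-1) n - n%:R * psi 3 n) / 30 :> rat.
Proof.
move=> n_gt1; have n_gt0 := ltnW n_gt1.
have -> : (n%:R ^+ 5 * psi (-1) n - n%:R * psi 3 n) / 30 =
    n%:R ^+ 5 / 30 * psi (-1) n + 0 * psi 1 n + - (n%:R / 30) * psi 3 n
    + 0 * psi 5 n by field.
rewrite -sum_moebius_laurent sum_coprime_mul // big_seq [RHS]big_seq.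
apply: eq_bigr => d.
rewrite -dvdn_divisors // => d_n; have d_gt0 := dvdn_gt0 n_gt0 d_n.
have d_neq0 : d%:R != 0 :> rat by rewrite pnatr_eq0 -lt0n.
have def_n : n%:R = d%:R * (n %/ d)%:R :> rat by rewrite -natrM mulnC divnK.
under eq_bigr => j _ do rewrite natrM.
by rewrite sum_sqr_mul_sub // def_n; congr (_ * _); field.
Qed.

(** Sum of f(a, n - a) - f(1, - 1) for f = (a^2 + a b + b^2)^3, because
  a^2 + a b + b^2 = (a + b)^2 - a b. *)
Lemma sum_coprime_cube (n : nat) : (1 < n)%N ->
  \sum_(1 <= a < n | coprime a n)
     ((n%:R ^+ 2 - a%:R * (n%:R - a%:R)) ^+ 3 - 1) =
  (83 / 140 * n%:R ^+ 7 - n%:R) * psi (-1) n + n%:R ^+ 5 / 2 * psi 1 n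
  - 7 / 60 * n%:R ^+ 3 * psi 3 n + n%:R / 42 * psi 5 n :> rat.
Proof.
move=> n_gt1; have n_gt0 := ltnW n_gt1.
rewrite -mulNr -sum_moebius_laurent sum_coprime_mul // big_seq [RHS]big_seq.
apply: eq_bigr => d.
rewrite -dvdn_divisors // => d_n; have d_gt0 := dvdn_gt0 n_gt0 d_n.
have d_neq0 : d%:R != 0 :> rat by rewrite pnatr_eq0 -lt0n.
have def_n : n%:R = d%:R * (n %/ d)%:R :> rat by rewrite -natrM mulnC divnK.
under eq_bigr => j _ do rewrite natrM.
by rewrite sum_cube_sub // def_n; congr (_ * _); field.
Qed.

(** * The two convolution sums *)

Lemma sum_sigma'_natr (r s n : nat) :
  \sum_(1 <= m < n) (sigma' r s m (n - m)%N)%:R =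
  \sum_(q <- prim_quads n) q.1.1%:R ^+ r * q.1.2%:R ^+ s :> rat.
Proof.
rewrite -natr_sum sum_sigma'E natr_sum.
by apply: eq_bigr => q _; rewrite natrM !natrX.
Qed.

Theorem theorem4 (n : nat) (n_gt1 : (1 < n)%N) :
  (\sum_(1 <= m < n) (sigma' 1 5 m (n - m)%N)%:R =
     (540 * n%:R ^+ 7 - 1134 * n%:R) / 13608 * psi (-1) n
     + n%:R ^+ 5 / 24 * psi 1 n
     + 9 * n%:R / 4536 * psi 5 n :> rat) /\
  (\sum_(1 <= m < n) (sigma' 3 3 m (n - m)%N)%:R =
     n%:R ^+ 7 / 120 * psi (-1) n - n%:R ^+ 3 / 120 * psi 3 n :> rat).
Proof.
rewrite !sum_sigma'_natr.
set S15 := (LHS in LHS = _ /\ _); set S33 := (LHS in _ /\ LHS = _).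
have S33E : 4 * S33 =
    n%:R ^+ 2 * ((n%:R ^+ 5 * psi (-1) n - n%:R * psi 3 n) / 30).
  rewrite -sum_coprime_sqr // !mulr_sumr.
  pose f (a b : rat) := a ^+ 2 * b ^+ 2 * (a + b) ^+ 2.
  have := @sum_prim_quads_descent _ _ n f.
  rewrite (eq_bigr (fun q => 4 * (q.1.1%:R ^+ 3 * q.1.2%:R ^+ 3))); last first.
    by move=> q _; rewrite /f; ring.
  move=> ->; [|by move=> a b; rewrite /f; ring..].
  by apply: eq_bigr => a _; rewrite /f; ring.
have S15E : 12 * S15 + 14 * S33 =
    (83 / 140 * n%:R ^+ 7 - n%:R) * psi (-1) n + n%:R ^+ 5 / 2 * psi 1 n
    - 7 / 60 * n%:R ^+ 3 * psi 3 n + n%:R / 42 * psi 5 n.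
  rewrite -sum_coprime_cube //.
  pose f (a b : rat) := (a ^+ 2 + a * b + b ^+ 2) ^+ 3.
  have S51E : \sum_(q <- prim_quads n) q.1.1%:R ^+ 5 * q.1.2%:R ^+ 1 = S15.
    rewrite -(@sum_prim_quads_swap _ n xpredT
                (fun a b => a%:R ^+ 5 * b%:R ^+ 1)).
    by apply: eq_bigr => q _; rewrite mulrC.
  have -> : 12 * S15 = 6 * S15 + 6 * S15 by ring.
  rewrite -{2}S51E !mulr_sumr -!big_split /=.
  have := @sum_prim_quads_descent _ _ n f.
  rewrite (eq_bigr (fun q => 6 * (q.1.1%:R ^+ 1 * q.1.2%:R ^+ 5)
    + 6 * (q.1.1%:R ^+ 5 * q.1.2%:R ^+ 1)
    + 14 * (q.1.1%:R ^+ 3 * q.1.2%:R ^+ 3))); last first.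
    by move=> q _; rewrite /f; ring.
  move=> ->; [|by move=> a b; rewrite /f; ring..].
  by apply: eq_bigr => a _; rewrite /f; ring.
by split; lra.
Qed.
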